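(* Let $G$ be a graph, $\theta$ a real number, $k=\mathrm{mult}(\theta,G)$ (possibly $0$), and let $X=\{x_1,\dots,x_m\}$ ($m\ge2$) be a $\theta$-nice set in $G$. Then there exists a set $Y=\{y_1,\dots,y_m\}\subseteq V(G)$ disjoint from $X$ such that: (i) $M=\{x_1y_1,\dots,x_my_m\}$ is a matching of size $m$ in $G$; (ii) for every $M'\subseteq M$, $\mathrm{mult}(\theta,G\setminus V(M'))=k$, where $V(M')$ is the set of endpoints of edges in $M'$, and if $|X\setminus V(M')|\ge2$ then $X\setminus V(M')$ is $\theta$-nice in $G\setminus V(M')$; (iii) $Y$ is an independent set in $G$.
   Context: All graphs are finite and simple. For a graph $G$ on $n$ vertices, let $p(G,r)$ be the number of $r$-matchings of $G$ ($p(G,0)=1$); the matching polynomial is $\mu(G,x)=\sum_{r=0}^{\lfloor n/2\rfloor}(-1)^r p(G,r)x^{n-2r}$ (the graph with no vertices has $\mu=1$). For real $\theta$, $\mathrm{mult}(\theta,G)$ is the multiplicity of $\theta$ as a root of $\mu(G,x)$ (it is $0$ if $\theta$ is not a root). $G\setminus X$ denotes deletion of the vertex set $X$ and its incident edges. A set $X\subseteq V(F)$ with $|X|>1$ is $\theta$-nice in a graph $F$ if $\mathrm{mult}(\theta,F\setminus\{u,v\})=\mathrm{mult}(\theta,F)+2$ for all distinct $u,v\in X$. *)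

(* Defs.v *)
From HB Require Import structures.
From mathcomp Require Import all_boot all_order all_algebra.
Set Implicit Arguments. Unset Strict Implicit. Unset Printing Implicit Defensive.
Import Order.TTheory GRing.Theory Num.Theory.

(* A finite simple graph is a finType T of vertices with a symmetric,
   irreflexive adjacency relation e.  Vertex deletion is modelled by working
   with the induced subgraph on a vertex set S : {set T}; G \ X is the induced
   subgraph on ~: X (resp. S :\: X). *)
Definition simple_graph (T : finType) (e : rel T) : Prop :=
  symmetric e /\ irreflexive e.

Definition is_edge_in (T : finType) (e : rel T) (S : {set T}) (f : {set T}) : bool :=
  [exists u, exists v, [&& u \in S, v \in S, e u v & f == [set u; v]]].

Definition is_matching (T : finType) (e : rel T) (S : {set T})
    (M : {set {set T}}) : bool :=
  [forall f in M, is_edge_in e S f] &&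
  [forall f in M, forall g in M, (f != g) ==> [disjoint f & g]].

Definition nmatch (T : finType) (e : rel T) (S : {set T}) (r : nat) : nat :=
  #|[set M : {set {set T}} | is_matching e S M && (#|M| == r)]|.

Definition match_poly (R : nzRingType) (T : finType) (e : rel T) (S : {set T})
    : {poly R} :=
  (\sum_(r < (#|S| %/ 2).+1)
     ((-1) ^+ r * (nmatch e S r)%:R) *: 'X^(#|S| - 2 * r))%R.

Definition mult (R : rcfType) (T : finType) (e : rel T) (theta : R)
    (S : {set T}) : nat :=
  mup theta (match_poly R e S).

Definition nice (R : rcfType) (T : finType) (e : rel T) (theta : R)
    (S X : {set T}) : Prop :=
  X \subset S /\ 1 < #|X| /\
  forall u v, u \in X -> v \in X -> u != v ->
    mult e theta (S :\ u :\ v) = (mult e theta S + 2)%N.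

(* Main.v *)
Require Import Defs.
From HB Require Import structures.
From mathcomp Require Import all_boot all_order all_algebra.
From mathcomp Require Import zify ring.
Set Implicit Arguments. Unset Strict Implicit. Unset Printing Implicit Defensive.
Import Order.TTheory GRing.Theory Num.Theory.

(** Everything rests on two sum-of-squares identities, both immediate
    inductions from the vertex recurrence of the matching polynomial: the
    Heilmann-Lieb identity
      mu(G-u) mu(G-v) - mu(G) mu(G-u-v) = sum over u-v paths P of mu(G-P)^2
    and its analogue for the Wronskian of mu(G-u) and mu(G). Comparing orders of
    vanishing at theta (a sum of squares vanishes to even order, and each square
    at least as much as the sum) gives interlacing, and shows that a nice set X
    is additive: mult(G - X') = k + |X'| for all X' in X. The case |X'| = 3,
    from which the others follow, perturbs the weight of one vertex in the
    Heilmann-Lieb identity.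

    The recurrence at x in X then yields a neighbour y with mult(G-x-y) = k, and
    X - x stays additive in G-x-y, so the partners are chosen greedily. For a
    submatching, restore the removed edges one at a time: the Wronskian identity
    gives the leading coefficients in the recurrence a common sign, so the
    multiplicity remains k. Finally mult(G-X) drops by one for every deleted
    partner; if two partners were adjacent, the edge between them would be a
    path contributing a square of too small order. *)

(** * Matchings in induced subgraphs and the vertex recurrence *)

Section Matchings.
Variables (T : finType) (e : rel T).
Hypotheses (e_sym : symmetric e) (e_irr : irreflexive e).
Implicit Types (S f : {set T}) (M : {set {set T}}) (u v z : T).

Lemma is_edge_inE S f :
  is_edge_in e S f = is_edge_in e setT f && (f \subset S).
Proof.
apply/idP/andP => [/existsP[u /existsP[v /and4P[uS vS uv /eqP->]]]|].
  split; last by rewrite subUset !sub1set uS vS.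
  by apply/existsP; exists u; apply/existsP; exists v; rewrite !inE uv eqxx.
case=> /existsP[u /existsP[v /and4P[_ _ uv /eqP->]]].
rewrite subUset !sub1set => /andP[uS vS].
by apply/existsP; exists u; apply/existsP; exists v; rewrite uS vS uv eqxx.
Qed.

(** In this form only the last conjunct mentions [S], so shrinking [S] is just a condition on the
    cover. *)
Lemma is_matchingE S M :
  is_matching e S M =
  [&& [forall f in M, is_edge_in e setT f], trivIset M & cover M \subset S].
Proof.
apply/andP/and3P => [[/forall_inP edM /forall_inP djM]|[/forall_inP edM tM sM]].
  split.
  - apply/forall_inP => f /edM; by rewrite is_edge_inE => /andP[].
  - apply/trivIsetP => f g fM gM fg.
    by move: (djM f fM) => /forall_inP /(_ g gM); rewrite fg.
  - apply/bigcupsP => f /edM; by rewrite is_edge_inE => /andP[].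
split; apply/forall_inP => f fM.
  rewrite is_edge_inE edM //=; exact: subset_trans (bigcup_sup f fM) sM.
apply/forall_inP => g gM; apply/implyP => fg.
by move/trivIsetP: tM; apply.
Qed.

Lemma card_edge S f : is_edge_in e S f -> #|f| = 2.
Proof.
move=> /existsP[u /existsP[v /and4P[_ _ uv /eqP->]]].
by rewrite cards2; case: eqP uv => [->|//]; rewrite e_irr.
Qed.

Lemma card_cover_matching S M : is_matching e S M -> #|cover M| = 2 * #|M|.
Proof.
rewrite is_matchingE => /and3P[/forall_inP edM /eqP <- _].
rewrite (eq_bigr (fun=> 2)) => [|f /edM]; last exact: card_edge.
by rewrite sum_nat_const mulnC.
Qed.

Lemma card_matching S M : is_matching e S M -> 2 * #|M| <= #|S|.
Proof.
move=> mM; rewrite -(card_cover_matching mM); apply: subset_leq_card.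
by move: mM; rewrite is_matchingE => /and3P[].
Qed.

Lemma is_matchingD1 S M u :
  is_matching e (S :\ u) M = is_matching e S M && (u \notin cover M).
Proof. by rewrite !is_matchingE subsetD1 !andbA. Qed.

Lemma edge_set_inj u v z : [set u; v] = [set u; z] -> v = z.
Proof.
move=> E; have := set21 v u; rewrite setUC E !inE => /orP[/eqP vu|/eqP//].
have := set22 u z; rewrite -E !inE => /orP[/eqP->//|/eqP->//].
Qed.

(** Adding the edge uz is the bijection that yields the second term of the vertex recurrence. *)
Lemma is_matchingU1 S M u z : u \in S -> z \in S :\ u -> e u z ->
  is_matching e S ([set u; z] |: M) && ([set u; z] \notin M) =
  is_matching e (S :\ u :\ z) M.
Proof.
move=> uS zSu uz; have zS : z \in S by case/setD1P: zSu.
rewrite !is_matchingE.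
apply/andP/and3P => [[/and3P[/forall_inP edM tM cM] nM]|[/forall_inP edM tM cM]].
  have dj g : g \in M -> [disjoint [set u; z] & g].
    move=> gM; move/trivIsetP: tM; apply; rewrite ?setU11 ?setU1r //.
    by apply: contraNneq nM => ->.
  split.
  - by apply/forall_inP => f fM; apply: edM; rewrite setU1r.
  - apply/trivIsetP => f g fM gM; move/trivIsetP: tM; apply; exact: setU1r.
  - apply/bigcupsP => f fM; rewrite !subsetD1.
    have sf : f \subset S by apply: subset_trans cM; apply: bigcup_sup; rewrite setU1r.
    have := dj f fM; rewrite disjoints_subset subUset !sub1set !inE sf /=.
    by case/andP=> -> ->.
have nf f : f \in M -> (u \notin f) && (z \notin f).
  move=> fM; have := subset_trans (bigcup_sup f fM) cM.
  by rewrite !subsetD1 => /andP[/andP[_ ->] ->].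
have nM : [set u; z] \notin M.
  by apply/negP => /nf; rewrite set21.
split=> //; apply/and3P; split.
- apply/forall_inP => f /setU1P[->|/edM//].
  by apply/existsP; exists u; apply/existsP; exists z; rewrite !inE uz eqxx.
- have dj g : g \in M -> [disjoint [set u; z] & g].
    by move=> /nf; rewrite disjoints_subset subUset !sub1set !inE.
  apply/trivIsetP => f g /setU1P[->|fM] /setU1P[->|gM] fg.
  + by rewrite eqxx in fg.
  + exact: dj.
  + by rewrite disjoint_sym; apply: dj.
  + by move/trivIsetP: tM; apply.
- apply/bigcupsP => f /setU1P[->|fM]; first by rewrite subUset !sub1set uS zS.
  have := subset_trans (bigcup_sup f fM) cM.
  by rewrite !subsetD1 => /andP[/andP[]].
Qed.

Lemma matching_edge_at S M u : is_matching e S M -> u \in cover M ->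
  exists z, [/\ z \in S :\ u, e u z & [set u; z] \in M].
Proof.
rewrite is_matchingE => /and3P[/forall_inP edM _ sM] /bigcupP[f fM].
have := edM f fM => /existsP[a /existsP[b /and4P[_ _ ab /eqP fE]]].
have : f \subset S by apply: subset_trans sM; exact: (bigcup_sup f).
rewrite fE subUset !sub1set => /andP[aS bS].
have ab' : a != b by apply: contraTneq ab => ->; rewrite e_irr.
rewrite !inE => /orP[] /eqP->.
  by exists b; rewrite !inE eq_sym ab' bS ab -fE.
by exists a; rewrite !inE ab' aS e_sym ab setUC -fE.
Qed.

Lemma matching_edge_uniq S M u v z : is_matching e S M ->
  [set u; v] \in M -> [set u; z] \in M -> v = z.
Proof.
rewrite is_matchingE => /and3P[_ /trivIsetP tM _] vM zM.
apply: (@edge_set_inj u); apply/eqP/negPn/negP => /(tM _ _ vM zM).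
by rewrite disjoints_subset subUset !sub1set !inE eqxx.
Qed.

Local Open Scope ring_scope.
Variable R : comNzRingType.
Local Notation mu S := (match_poly R e S).

Lemma match_polyE S :
  mu S = \sum_(M | is_matching e S M) (-1) ^+ #|M| *: 'X^(#|S| - 2 * #|M|).
Proof.
have bM M : is_matching e S M -> (#|M| < (#|S| %/ 2).+1)%N.
  by move=> /card_matching; lia.
rewrite (partition_big (fun M => inord #|M| : 'I_(#|S| %/ 2).+1) xpredT) //=.
apply: eq_bigr => r _.
rewrite (eq_bigr (fun=> (-1) ^+ r *: 'X^(#|S| - 2 * r))); last first.
  by move=> M /andP[mM /eqP <-]; rewrite inordK ?bM.
rewrite sumr_const scalerMnl mulr_natr; congr (_ *+ _ *: _).
rewrite /nmatch; apply: eq_card => M; rewrite inE unfold_in.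
case mM: (is_matching e S M) => //=.
by rewrite -val_eqE /= inordK ?bM.
Qed.

(** Matchings missing [u] give the first term; the others are sorted by the partner of [u], and the
    removed edge accounts for the sign. *)
Lemma match_poly_rec S u : u \in S ->
  mu S = 'X * mu (S :\ u) - \sum_(z in S :\ u | e u z) mu (S :\ u :\ z).
Proof.
move=> uS; have cS : #|S| = #|S :\ u|.+1 by rewrite (cardsD1 u) uS.
rewrite [LHS]match_polyE (bigID (fun M => u \notin cover M)) /=.
congr (_ + _).
  rewrite match_polyE mulr_sumr; apply: eq_big => M.
    by rewrite is_matchingD1.
  rewrite -is_matchingD1 => /card_matching bM.
  by rewrite -scalerAr -exprS cS subSn.
(* The partner of [u]; the default [u] never occurs for a matching covering [u]. *)
pose p M := odflt u [pick z | [set u; z] \in M].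
have pE M z : is_matching e S M -> [set u; z] \in M -> p M = z.
  rewrite /p => mM zM; case: pickP => [v vM|/(_ z)]; last by rewrite zM.
  exact: matching_edge_uniq mM vM zM.
rewrite (partition_big p (fun z => (z \in S :\ u) && e u z)) /=; last first.
  move=> M /andP[mM /negPn /(matching_edge_at mM)[z [zS uz zM]]].
  by rewrite (pE M z) // zS.
rewrite -sumrN; apply: eq_bigr => z /andP[zS uz].
have cSz : #|S :\ u| = #|S :\ u :\ z|.+1 by rewrite (cardsD1 z) zS.
rewrite match_polyE -sumrN.
rewrite (reindex_onto (fun M => [set u; z] |: M) (fun M => M :\ [set u; z])) /=.
  apply: eq_big => M.
    rewrite -is_matchingU1 //; apply/idP/idP.
      case/andP=> /andP[/andP[-> _] _] /eqP E /=.
      by apply/negP; rewrite -E !inE eqxx.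
    case/andP=> mM nM; rewrite mM setU1K // eqxx andbT (pE _ z mM) ?setU11 //.
    rewrite eqxx andbT /=; apply/negPn/bigcupP.
    by exists [set u; z]; rewrite ?setU11 ?set21.
  case/andP=> _ /eqP E.
  have nM : [set u; z] \notin M by rewrite -E !inE eqxx.
  rewrite cardsU1 nM /= add1n exprS mulN1r scaleNr cS cSz.
  by congr (- (_ *: 'X^ _)); lia.
move=> M /andP[/andP[mM /negPn cM] /eqP pM].
have [v [_ _ vM]] := matching_edge_at mM cM.
by rewrite setD1K // -pM (pE M v).
Qed.

Lemma match_poly0 : mu set0 = 1.
Proof.
rewrite match_polyE (big_pred1 set0) => [|M].
  by rewrite !cards0 expr0 scale1r.
apply/idP/eqP => [/card_matching|->]; first by rewrite cards0 leqn0 muln_eq0 cards_eq0 => /eqP.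
rewrite is_matchingE /cover big_set0 sub0set; apply/and3P; split=> //.
  by apply/forall_inP => f; rewrite inE.
by apply/trivIsetP => f g; rewrite inE.
Qed.

Lemma size_match_poly S : size (mu S) = #|S|.+1.
Proof.
have [n] := ubnP #|S|; elim: n S => // n IH S leSn.
have [->|[u uS]] := set_0Vmem S; first by rewrite match_poly0 size_polyC oner_eq0 cards0.
have cS : #|S| = #|S :\ u|.+1 by rewrite (cardsD1 u) uS.
have sX : size ('X * mu (S :\ u)) = #|S|.+1.
  rewrite -commr_polyX size_mulX ?IH ?cS //; first by rewrite cS in leSn.
  by rewrite -size_poly_eq0 IH //; lia.
rewrite (match_poly_rec uS) size_polyDl sX // size_polyN.
apply: leq_ltn_trans (size_sum _ _ _) _; rewrite ltnS.
apply/bigmax_leqP => z /andP[zS _].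
have cSz : #|S :\ u| = #|S :\ u :\ z|.+1 by rewrite (cardsD1 z) zS.
by rewrite IH; lia.
Qed.

Lemma match_poly_neq0 S : mu S != 0.
Proof. by rewrite -size_poly_eq0 size_match_poly. Qed.

End Matchings.

(** * Orders of vanishing of sums of squares *)

Section SumsOfSquares.
Local Open Scope ring_scope.
Variables (R : realFieldType) (a : R) (I : eqType).
Implicit Types (L : seq I) (F : I -> {poly R}).

Lemma sos_root L F : root (\sum_(i <- L) F i ^+ 2) a ->
  {in L, forall i, root (F i) a}.
Proof.
rewrite /root horner_sum => rF i iL.
have : all (fun i => true ==> ((F i ^+ 2).[a] == 0)) L.
  by rewrite -psumr_eq0 // => j _; rewrite horner_exp sqr_ge0.
by move/allP/(_ i iL); rewrite /= horner_exp sqrf_eq0.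
Qed.

(** If the sum vanishes at [a], so does every [F i]; dividing by the square of the linear factor
    allows induction. An odd exponent suffices because the order is even. *)
Lemma sos_dvdp_odd n L F :
  ('X - a%:P) ^+ (2 * n).+1 %| \sum_(i <- L) F i ^+ 2 ->
  {in L, forall i, ('X - a%:P) ^+ n.+1 %| F i}.
Proof.
elim: n F => [|n IH] F dF i iL.
  rewrite expr1 dvdp_XsubCl; apply: sos_root iL.
  by rewrite -dvdp_XsubCl; rewrite muln0 in dF.
have rF : {in L, forall j, F j = ('X - a%:P) * (F j %/ ('X - a%:P))}.
  move=> j jL; rewrite mulrC divpK // dvdp_XsubCl; apply: (@sos_root L) jL.
  rewrite -dvdp_XsubCl; apply: dvdp_trans dF.
  by rewrite exprS dvdp_mulr.
have EF : \sum_(i <- L) F i ^+ 2 =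
    ('X - a%:P) ^+ 2 * \sum_(i <- L) (F i %/ ('X - a%:P)) ^+ 2.
  rewrite mulr_sumr !big_seq; apply: eq_bigr => j jL.
  by rewrite {1}rF // exprMn.
rewrite rF // exprS dvdp_mul2l ?polyXsubC_eq0 //.
apply: (IH (fun j => F j %/ ('X - a%:P))) iL.
move: dF; rewrite EF (_ : (2 * n.+1).+1 = 2 + (2 * n).+1)%N; last lia.
by rewrite exprD dvdp_mul2l // expf_neq0 // polyXsubC_eq0.
Qed.

Lemma sos_dvdp_even n L F :
  ('X - a%:P) ^+ (2 * n) %| \sum_(i <- L) F i ^+ 2 ->
  {in L, forall i, ('X - a%:P) ^+ n %| F i}.
Proof.
case: n => [|n] dF i iL; first by rewrite dvd1p.
apply: sos_dvdp_odd iL; apply: dvdp_trans dF; apply: dvdp_exp2l; lia.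
Qed.

Lemma dvdp_sos n L F : {in L, forall i, ('X - a%:P) ^+ n %| F i} ->
  ('X - a%:P) ^+ (2 * n) %| \sum_(i <- L) F i ^+ 2.
Proof.
move=> dF; rewrite big_seq; apply: (big_ind (fun p => _ %| p)) => [|p q|i iL].
- exact: dvdp0.
- exact: dvdp_add.
- by rewrite mulnC exprM; apply: dvdp_exp2r; apply: dF.
Qed.

End SumsOfSquares.

(** * Path identities derived from the vertex recurrence *)

Lemma setD1C (T : finType) (S : {set T}) u v : S :\ u :\ v = S :\ v :\ u.
Proof. by rewrite !setDDl setUC. Qed.

Section Identities.
Local Open Scope ring_scope.
Variables (T : finType) (e : rel T).
Implicit Types (S : {set T}) (u v z w : T).

(** The recurrence of a matching polynomial with vertex weights [W]; the ordinary one has all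
    weights equal to ['X]. General weights make room for the later perturbation. *)
Definition weighted_rec (K : comPzRingType) (W : T -> K) (C : {set T} -> K) :=
  forall S u, u \in S ->
  C S = W u * C (S :\ u) - \sum_(z in S :\ u | e u z) C (S :\ u :\ z).

(** Expand [C S] and [C (S :\ v)] at [u]: the weight cancels, z = v gives the square for the path
    uv, and each other z continues a path from z to v in [S :\ u]. *)
Lemma heilmann_lieb_step (K : comPzRingType) (W : T -> K) C S u v :
  weighted_rec W C -> u \in S -> v \in S :\ u ->
  C (S :\ u) * C (S :\ v) - C S * C (S :\ u :\ v) =
  (if e u v then C (S :\ u :\ v) ^+ 2 else 0) +
  \sum_(z in S :\ u :\ v | e u z)
     (C (S :\ u :\ z) * C (S :\ u :\ v) - C (S :\ u) * C (S :\ u :\ z :\ v)).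
Proof.
move=> rC uS vS; have [vu vS'] := setD1P vS.
have uSv : u \in S :\ v by rewrite !inE eq_sym vu.
rewrite (rC S u uS) (rC (S :\ v) u uSv) (setD1C S v u) sumrB -mulr_suml -mulr_sumr.
rewrite (eq_bigr (fun z => C (S :\ u :\ z :\ v))); last first.
  by move=> z _; rewrite setD1C.
set s2 := \sum_(z in _ | _) C (_ :\ _ :\ _ :\ _).
have -> : \sum_(z in S :\ u | e u z) C (S :\ u :\ z) =
    (if e u v then C (S :\ u :\ v) else 0) +
    \sum_(z in S :\ u :\ v | e u z) C (S :\ u :\ z).
  rewrite (bigID (pred1 v)) /=; congr (_ + _).
    case uv: (e u v).
      rewrite (big_pred1 v) // => z; apply/andP/eqP => [[_ /eqP]//|->].
      by rewrite vS uv.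
    by rewrite big_pred0 // => z; case: eqP => [->|_]; rewrite ?uv !andbF.
  by apply: eq_bigl => z; rewrite !inE; case: (z == v); rewrite ?andbF ?andbT /=.
by case: (e u v); ring.
Qed.

(* The list [L] enumerates the complements of the paths from [u] to [v]; it
   does not depend on the weights. *)
Lemma heilmann_lieb S u v : u \in S -> v \in S :\ u ->
  exists L : seq {set T}, (e u v -> S :\ u :\ v \in L) /\
  forall (K : comPzRingType) (W : T -> K) C, weighted_rec W C ->
  C (S :\ u) * C (S :\ v) - C S * C (S :\ u :\ v) = \sum_(Z <- L) C Z ^+ 2.
Proof.
have [n] := ubnP #|S|; elim: n S u v => // n IH S u v leSn uS vS.
have cS : (#|S :\ u| < n)%N by move: leSn; rewrite (cardsD1 u) uS.
pose P z (L : seq {set T}) := z \in S :\ u :\ v ->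
  forall (K : comPzRingType) (W : T -> K) C, weighted_rec W C ->
  C (S :\ u :\ z) * C (S :\ u :\ v) - C (S :\ u) * C (S :\ u :\ z :\ v)
  = \sum_(Z <- L) C Z ^+ 2.
have /fin_all_exists [L HL] : forall z, exists L, P z L.
  move=> z; case zS: (z \in S :\ u :\ v); last by exists [::]; rewrite /P zS.
  have [zv zS'] := setD1P zS.
  have [|L [_ HL]] := IH (S :\ u) z v cS zS'; first by rewrite in_setD1 eq_sym zv.
  by exists L => _.
exists ((if e u v then [:: S :\ u :\ v] else [::]) ++
   flatten [seq L z | z <- enum [pred z | (z \in S :\ u :\ v) && e u z]]).
split=> [->|K W C rC]; first by rewrite mem_head.
rewrite (heilmann_lieb_step rC) // big_cat big_flatten big_map big_enum_cond /=.
congr (_ + _); first by case: (e u v); rewrite ?big_seq1 ?big_nil.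
rewrite [RHS](eq_bigl (fun z => (z \in S :\ u :\ v) && e u z)); last first.
  by move=> z; rewrite andbT.
by apply: eq_bigr => z /andP[zS _]; apply: HL rC.
Qed.

(** [L] collects the complements of all paths starting at [u]. Differentiating the weight ['X] in
    the recurrence produces the square for the one-vertex path, and the rest is the Wronskian at
    each neighbour. *)
Lemma wronskian_sos (R : comNzRingType) (A : {set T} -> {poly R}) S u :
  weighted_rec (fun=> 'X) A -> u \in S ->
  exists L : seq {set T}, S :\ u \in L /\
  A (S :\ u) * (A S)^`() - (A (S :\ u))^`() * A S = \sum_(Z <- L) A Z ^+ 2.
Proof.
move=> rA; have [n] := ubnP #|S|; elim: n S u => // n IH S u leSn uS.
have cS : (#|S :\ u| < n)%N by move: leSn; rewrite (cardsD1 u) uS.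
pose P z (L : seq {set T}) := z \in S :\ u ->
  A (S :\ u :\ z) * (A (S :\ u))^`() - (A (S :\ u :\ z))^`() * A (S :\ u)
  = \sum_(Z <- L) A Z ^+ 2.
have /fin_all_exists [L HL] : forall z, exists L, P z L.
  move=> z; case zS: (z \in S :\ u); last by exists [::]; rewrite /P zS.
  by have [L [_ HL]] := IH (S :\ u) z cS zS; exists L.
exists ((S :\ u) ::
   flatten [seq L z | z <- enum [pred z | (z \in S :\ u) && e u z]]).
split; first by rewrite mem_head.
rewrite big_cons big_flatten big_map big_enum_cond /=.
rewrite [X in _ = _ + X](eq_bigl (fun z => (z \in S :\ u) && e u z)); last first.
  by move=> z; rewrite andbT.
rewrite -(eq_bigr _ (fun z zP => HL z (proj1 (andP zP)))) sumrB.
rewrite -!mulr_suml (rA S u uS) derivB derivM derivX raddf_sum /=; ring.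
Qed.

End Identities.

(** * Multiplicity of theta under vertex deletion *)

Section Multiplicity.
Local Open Scope ring_scope.
Variables (R : rcfType) (T : finType) (e : rel T) (theta : R).
Hypotheses (e_sym : symmetric e) (e_irr : irreflexive e).
Implicit Types (S X Y : {set T}) (u v w z : T).
Local Notation mu S := (match_poly R e S).
Local Notation m S := (mult e theta S).
Local Notation s := ('X - theta%:P).

Let s_neq0 n : s ^+ n != 0. Proof. by rewrite expf_neq0 ?polyXsubC_eq0. Qed.

Lemma match_poly_weighted_rec : weighted_rec e (fun=> 'X) (match_poly R e).
Proof. by move=> S u uS; rewrite -match_poly_rec. Qed.

Lemma mult_geq S n : (n <= m S)%N = (s ^+ n %| mu S).
Proof. by rewrite /mult mup_geq ?match_poly_neq0. Qed.

Lemma dvdp_mult S n : (n <= m S)%N -> s ^+ n %| mu S.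
Proof. by rewrite mult_geq. Qed.

Lemma dvdp_mu_mul S S' n : (s ^+ n %| mu S * mu S') = (n <= m S + m S')%N.
Proof. by rewrite -mupM ?mup_geq ?mulf_neq0 ?match_poly_neq0. Qed.

Lemma dvdp_deriv n (p : {poly R}) : s ^+ n.+1 %| p -> s ^+ n %| p^`().
Proof.
case/dvdpP => q ->; rewrite derivM deriv_exp derivXsubC mul1r /=.
apply: dvdp_add; apply: dvdp_mull; first by rewrite exprS dvdp_mull.
by rewrite -mulr_natl dvdp_mull.
Qed.

(** Put b = mult(G-u). If mult(G) were at least b+2, the Wronskian would vanish to order 2b+1,
    forcing its summand mu(G-u)^2 to vanish to order 2b+2. *)
Lemma mult_le_del S u : (m S <= (m (S :\ u)).+1)%N.
Proof.
have [uS|uS] := boolP (u \in S); last first.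
  by rewrite (setDidPl _) // disjoint_sym disjoints1.
rewrite leqNgt; apply/negP => lt_m.
have [L [uL WL]] := wronskian_sos match_poly_weighted_rec uS.
suff : ((m (S :\ u)).+1 <= m (S :\ u))%N by rewrite ltnn.
rewrite mult_geq; apply: sos_dvdp_odd uL; rewrite -WL.
set b := m (S :\ u) in lt_m *.
have d0 : s ^+ b %| mu (S :\ u) by apply: dvdp_mult.
apply: dvdp_sub.
  rewrite mul2n -addnn -addnS exprD; apply: dvdp_mul => //.
  by apply: dvdp_deriv; apply: dvdp_mult.
(* For b = 0 the derivative supplies no factor, and [mu S] alone gives the required one. *)
case: b d0 lt_m => [|b] d0 lt_m.
  by apply: dvdp_mull; apply: dvdp_mult; lia.
rewrite (_ : (2 * b.+1).+1 = b + b.+3)%N; last lia.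
by rewrite exprD; apply: dvdp_mul; [apply: dvdp_deriv | apply: dvdp_mult].
Qed.

(** By [mult_le_del], every term of the recurrence at [u] vanishes to order at least mult(G-u) -
    1. *)
Lemma mult_del_le S u : (m (S :\ u) <= (m S).+1)%N.
Proof.
have [uS|uS] := boolP (u \in S); last first.
  by rewrite (setDidPl _) // disjoint_sym disjoints1.
case E: (m (S :\ u)) => [//|b]; rewrite ltnS mult_geq (match_poly_rec e_sym e_irr R uS).
apply: dvdp_sub; first by apply/dvdp_mull/dvdp_mult; rewrite E.
apply: (big_ind (fun p => _ %| p)) => [|p q|z _]; first exact: dvdp0.
  exact: dvdp_add.
by apply: dvdp_mult; have := mult_le_del (S :\ u) z; rewrite E.
Qed.

Lemma mult_le_setD S Y : (m S <= m (S :\: Y) + #|Y|)%N.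
Proof.
have [n] := ubnP #|Y|; elim: n Y => // n IH Y.
have [->|[y yY]] := set_0Vmem Y; first by rewrite setD0 cards0 addn0.
rewrite (cardsD1 y) yY => cY; apply: leq_trans (IH (Y :\ y) _) _ => //.
have -> : S :\: Y = (S :\: (Y :\ y)) :\ y by rewrite setDDl setUC setD1K.
by have := mult_le_del (S :\: (Y :\ y)) y; lia.
Qed.

Lemma mult_setD_le S Y : (m (S :\: Y) <= m S + #|Y|)%N.
Proof.
have [n] := ubnP #|Y|; elim: n Y => // n IH Y.
have [->|[y yY]] := set_0Vmem Y; first by rewrite setD0 cards0 addn0.
rewrite (cardsD1 y) yY => cY; have := IH (Y :\ y) cY.
have -> : S :\: Y = (S :\: (Y :\ y)) :\ y by rewrite setDDl setUC setD1K.
by have := mult_del_le (S :\: (Y :\ y)) y; lia.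
Qed.

(** Otherwise every term of the recurrence at [u] would vanish to order mult(G) + 1. *)
Lemma exists_essential_neighbour S u : u \in S -> m (S :\ u) = (m S).+1 ->
  exists z, [/\ z \in S :\ u, e u z & m (S :\ u :\ z) = m S].
Proof.
move=> uS mu1.
have [/existsP[z /and3P[? ? /eqP ?]]|/existsPn no] :=
  boolP [exists z, [&& z \in S :\ u, e u z & m (S :\ u :\ z) == m S]].
  by exists z.
suff : ((m S).+1 <= m S)%N by rewrite ltnn.
rewrite mult_geq (match_poly_rec e_sym e_irr R uS).
apply: dvdp_sub; first by apply/dvdp_mull/dvdp_mult; rewrite mu1.
apply: (big_ind (fun p => _ %| p)) => [|p q|z /andP[zS uz]]; first exact: dvdp0.
  exact: dvdp_add.
apply: dvdp_mult; have := no z; rewrite zS uz /=.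
by have := mult_le_del (S :\ u) z; rewrite mu1; lia.
Qed.

(** After division by [s ^+ (2 * l)] the Wronskian takes the value p(theta) a(theta) at theta, and
    it is still a sum of squares. *)
Lemma essential_residue_ge0 S y l a p : y \in S ->
  mu S = s ^+ l.+1 * a -> mu (S :\ y) = s ^+ l * p -> 0 <= p.[theta] * a.[theta].
Proof.
move=> yS Ea Ep.
have [L [_]] := wronskian_sos match_poly_weighted_rec yS.
have -> : mu (S :\ y) * (mu S)^`() - (mu (S :\ y))^`() * mu S =
    s ^+ (2 * l) * (p * a + s * (p * a^`() - p^`() * a)).
  rewrite Ea Ep !derivM !deriv_exp derivXsubC !mul1r mulnC exprM expr2.
  by case: l {Ea Ep} => [|l] /=; move: s => t; rewrite ?exprS ?mulr0n; ring.
move=> WL; have dL : {in L, forall Z, s ^+ l %| mu Z}.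
  by apply: sos_dvdp_even; rewrite -WL dvdp_mulIl.
have /(mulfI (s_neq0 _)) E : s ^+ (2 * l) * (p * a + s * (p * a^`() - p^`() * a)) =
    s ^+ (2 * l) * \sum_(Z <- L) (mu Z %/ s ^+ l) ^+ 2.
  rewrite WL mulr_sumr !big_seq; apply: eq_bigr => Z ZL.
  by rewrite -{1}(divpK (dL Z ZL)) exprMn mulrC mulnC exprM.
have := congr1 (horner^~ theta) E.
rewrite !hornerE subrr mul0r addr0 horner_sum => ->.
by apply: sumr_ge0 => Z _; rewrite horner_exp sqr_ge0.
Qed.

(* By [essential_residue_ge0] the leading terms at [theta] in the recurrence
   for [mu S] all have the same sign, so they cannot cancel. *)
Lemma special_positive S u z : u \in S -> z \in S :\ u -> e u z ->
  m (S :\ u) = (m (S :\ u :\ z)).+1 -> m S = m (S :\ u :\ z).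
Proof.
move=> uS zS uz E; set l := m (S :\ u :\ z) in E *.
apply/eqP; rewrite eqn_leq; apply/andP; split; last first.
  by have := mult_del_le S u; rewrite E.
rewrite leqNgt; apply/negP; rewrite mult_geq => dS.
have [a Ea] : exists a, mu (S :\ u) = s ^+ l.+1 * a.
  have /dvdpP[a ->] : s ^+ l.+1 %| mu (S :\ u) by apply: dvdp_mult; rewrite E.
  by exists a; rewrite mulrC.
have aN0 : a.[theta] != 0.
  apply/negP => ra; have : (l.+2 <= m (S :\ u))%N.
    by rewrite mult_geq Ea exprSr dvdp_mul2l // dvdp_XsubCl.
  by rewrite E ltnn.
pose p y := mu (S :\ u :\ y) %/ s ^+ l.
have Ep y : y \in S :\ u -> mu (S :\ u :\ y) = s ^+ l * p y.
  move=> yS; rewrite mulrC divpK //; apply: dvdp_mult.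
  by have := mult_le_del (S :\ u) y; rewrite E.
have pz : (p z).[theta] != 0.
  apply/negP => rp; have : (l.+1 <= m (S :\ u :\ z))%N.
    by rewrite mult_geq Ep // exprSr dvdp_mul2l // dvdp_XsubCl.
  by rewrite ltnn.
have ge0 y : y \in S :\ u -> 0 <= (p y).[theta] * a.[theta].
  by move=> yS; apply: essential_residue_ge0 Ea (Ep y yS).
(* The first term keeps an extra factor [s], so at theta only the sum of the [p y] survives. *)
have ES : mu S = s ^+ l * ('X * s * a - \sum_(y in S :\ u | e u y) p y).
  rewrite (match_poly_rec e_sym e_irr R uS) Ea exprSr.
  rewrite (eq_bigr (fun y => s ^+ l * p y)) => [|y /andP[yS _]]; last exact: Ep.
  by rewrite -mulr_sumr [RHS]mulrBr; congr (_ - _); rewrite -!mulrA mulrCA.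
move: dS; rewrite ES exprSr dvdp_mul2l // dvdp_XsubCl => /eqP.
rewrite !hornerE subrr mulr0 mul0r sub0r horner_sum => /eqP.
rewrite oppr_eq0 => /eqP sum0.
have : \sum_(y in S :\ u | e u y) (p y).[theta] * a.[theta] == 0.
  by rewrite -mulr_suml sum0 mul0r.
rewrite psumr_eq0 => [|y /andP[yS _]]; last exact: ge0.
move/allP/(_ z (mem_index_enum _)); rewrite zS uz /= mulf_eq0.
by rewrite (negPf pz) (negPf aN0).
Qed.

(** With k = mult(G), the Heilmann-Lieb difference vanishes to order 2k+1, hence to order 2k+2 as a
    sum of squares; this excludes k+1 for mult(G-u-v). *)
Lemma mult_del2_parity S u v : u \in S -> v \in S :\ u ->
  m (S :\ u) = (m S).+1 -> m (S :\ v) = (m S).+1 ->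
  (m S < m (S :\ u :\ v))%N -> m (S :\ u :\ v) = (m S).+2.
Proof.
move=> uS vS Eu Ev lt; apply/eqP; rewrite eqn_leq; apply/andP; split.
  by have := mult_del_le (S :\ u) v; rewrite Eu.
have [L [_ /(_ _ _ _ match_poly_weighted_rec) /= HL]] := heilmann_lieb e uS vS.
have duv : s ^+ (2 * (m S).+1) %| mu (S :\ u) * mu (S :\ v).
  by rewrite dvdp_mu_mul Eu Ev; lia.
have : s ^+ (2 * (m S).+1) %| mu S * mu (S :\ u :\ v).
  rewrite -(dvdp_subr _ duv) HL; apply/dvdp_sos/sos_dvdp_odd; rewrite -HL.
  apply: dvdp_sub; first by apply: dvdp_trans duv; apply: dvdp_exp2l; lia.
  by rewrite dvdp_mu_mul; lia.
by rewrite dvdp_mu_mul; lia.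
Qed.

(** The Heilmann-Lieb difference vanishes to order 2l+2, whereas the path uv would contribute a
    square of order 2l. *)
Lemma essential_pair_nonadjacent S u v l : u \in S -> v \in S :\ u ->
  m S = l.+2 -> m (S :\ u) = l.+1 -> m (S :\ v) = l.+1 ->
  m (S :\ u :\ v) = l -> ~~ e u v.
Proof.
move=> uS vS E Eu Ev Euv; apply/negP => uv.
have [L [/(_ uv) uvL /(_ _ _ _ match_poly_weighted_rec) /= HL]] := heilmann_lieb e uS vS.
suff : (l.+1 <= m (S :\ u :\ v))%N by rewrite Euv ltnn.
rewrite mult_geq; apply: sos_dvdp_even uvL; rewrite -HL.
by apply: dvdp_sub; rewrite dvdp_mu_mul ?E ?Eu ?Ev ?Euv; lia.
Qed.

(** The coefficient of [c] in the matching polynomial when [w] has weight ['X] + c. *)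
Definition del1_poly w S : {poly R} := if w \in S then mu (S :\ w) else 0.

Lemma shifted_weighted_rec w (c : R) :
  weighted_rec e (fun u => 'X + (if u == w then c%:P else 0))
    (fun S => mu S + c *: del1_poly w S).
Proof.
move=> S u uS; rewrite big_split /= -scaler_sumr {1}(match_poly_rec e_sym e_irr R uS).
suff H : del1_poly w S + \sum_(z in S :\ u | e u z) del1_poly w (S :\ u :\ z) =
    'X * del1_poly w (S :\ u) + (if u == w then mu (S :\ u) else 0).
  rewrite -(addrK (\sum_(z in S :\ u | e u z) del1_poly w (S :\ u :\ z)) (del1_poly w S)) H.
  case: (eqVneq u w) => [uw|_]; last by rewrite -!mul_polyC; ring.
  by rewrite -!mul_polyC [del1_poly w (S :\ u)]/del1_poly uw !inE eqxx /=; ring.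
rewrite /del1_poly; case: (eqVneq u w) => [<-|uw].
  rewrite uS !inE eqxx /= big1 => [|z]; first by ring.
  by rewrite !inE eqxx andbF.
have [wS|wS] := boolP (w \in S); last first.
  rewrite !inE (negPf wS) andbF big1 => [|z _]; first by ring.
  by rewrite !inE (negPf wS) !andbF.
have uSw : u \in S :\ w by rewrite !inE uw.
rewrite !inE eq_sym uw wS /= (match_poly_rec e_sym e_irr R uSw) (setD1C S w u) addr0.
rewrite -[RHS]addr0 -addrA; congr (_ + _); apply/eqP; rewrite addrC subr_eq0; apply/eqP.
rewrite (bigID (pred1 w)) /= big1 => [|z /andP[_ /eqP->]]; last by rewrite !inE eqxx.
rewrite add0r; apply: eq_big => z.
  by rewrite !inE; case: (z == w); rewrite ?andbF ?andbT.
case/andP=> _ zw; rewrite !inE eq_sym (negPf zw) (eq_sym w u) (negPf uw) wS /=.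
by rewrite setD1C.
Qed.

(* Perturbing the weight of [w] by [c] makes the Heilmann-Lieb identity a
   quadratic polynomial in [c] that is a sum of squares; a power of [s] dividing
   its two extreme coefficients therefore divides the middle one. *)
Lemma heilmann_lieb_polar S u v w n :
  u \in S -> v \in S :\ u -> w \in S :\ u :\ v ->
  s ^+ (2 * n) %| mu (S :\ u) * mu (S :\ v) - mu S * mu (S :\ u :\ v) ->
  s ^+ (2 * n) %| mu (S :\ u :\ w) * mu (S :\ v :\ w) -
                  mu (S :\ w) * mu (S :\ u :\ v :\ w) ->
  s ^+ (2 * n) %| mu (S :\ u) * mu (S :\ v :\ w) + mu (S :\ u :\ w) * mu (S :\ v)
                  - mu S * mu (S :\ u :\ v :\ w) - mu (S :\ w) * mu (S :\ u :\ v).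
Proof.
move=> uS vS wS; set Q := (X in _ %| X -> _); set P := (X in _ -> _ %| X -> _).
set N := (X in _ -> _ -> _ %| X) => dQ dP.
have [wv wSu] := setD1P wS; have [wu wS'] := setD1P wSu.
have [L [_ HL]] := heilmann_lieb e uS vS.
set B := del1_poly w.
have HQ : \sum_(Z <- L) (mu Z) ^+ 2 = Q by rewrite -(HL _ _ _ match_poly_weighted_rec).
have HC c : \sum_(Z <- L) (mu Z + c *: B Z) ^+ 2 = Q + c *: N + c ^+ 2 *: P.
  rewrite -(HL _ _ _ (shifted_weighted_rec w c)) /B /del1_poly !inE wv wu wS' /=.
  by rewrite -!mul_polyC polyC_exp /Q /N /P; ring.
(* Adding the identities for c = 1 and c = -1 eliminates the middle coefficient [N]. *)
have HP : \sum_(Z <- L) B Z ^+ 2 = P.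
  have E2 : 2%:R *: (\sum_(Z <- L) B Z ^+ 2 - P) = 0.
    have E : \sum_(Z <- L) (mu Z + 1 *: B Z) ^+ 2 +
        \sum_(Z <- L) (mu Z + (-1) *: B Z) ^+ 2
        = 2%:R *: (\sum_(Z <- L) mu Z ^+ 2 + \sum_(Z <- L) B Z ^+ 2).
      rewrite -!big_split /= scaler_sumr; apply: eq_bigr => Z _.
      by rewrite scale1r scaleN1r scaler_nat mulr2n; ring.
    rewrite scalerBr -[X in X - _](addKr (2%:R *: Q)) -scalerDr.
    rewrite -[in X in _ + X - _]HQ -E !HC.
    by rewrite sqrrN expr1n !scale1r scaleN1r !scaler_nat !mulr2n; ring.
  by move/eqP: E2; rewrite scaler_eq0 pnatr_eq0 subr_eq0 /= => /eqP.
have := HC 1; rewrite expr1n !scale1r => H.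
rewrite -(dvdp_addr _ dQ) -(dvdp_addl _ dP) -H; apply: dvdp_sos => Z ZL.
rewrite scale1r; apply: dvdp_add.
  by move: ZL; apply: sos_dvdp_even; rewrite HQ.
by move: ZL; apply: sos_dvdp_even; rewrite HP.
Qed.

(** With k = mult(G), all products in the polarised identity other than mu(G) mu(G-u-v-w) are known
    to vanish to order 2k+2, so this one does too. *)
Lemma mult_del3 S u v w : u \in S -> v \in S :\ u -> w \in S :\ u :\ v ->
  m (S :\ u) = (m S).+1 -> m (S :\ v) = (m S).+1 -> m (S :\ w) = (m S).+1 ->
  m (S :\ u :\ v) = (m S).+2 -> m (S :\ u :\ w) = (m S).+2 ->
  m (S :\ v :\ w) = (m S).+2 -> m (S :\ u :\ v :\ w) = (m S).+3.
Proof.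
move=> uS vS wS Eu Ev Ew Euv Euw Evw.
have Guvw := mult_le_del (S :\ u :\ v) w.
suff lt : (m S + 2 <= m (S :\ u :\ v :\ w))%N.
  (* Parity in [S :\ u], of multiplicity k+1, lifts the bound k+2 to the value k+3. *)
  by rewrite (mult_del2_parity vS) ?Eu //; lia.
have dN := @heilmann_lieb_polar S u v w (m S).+1 uS vS wS.
suff : s ^+ (2 * (m S).+1) %| mu S * mu (S :\ u :\ v :\ w).
  by rewrite dvdp_mu_mul; lia.
have d1 : s ^+ (2 * (m S).+1) %|
    mu (S :\ u) * mu (S :\ v :\ w) + mu (S :\ u :\ w) * mu (S :\ v).
  by apply: dvdp_add; rewrite dvdp_mu_mul ?Eu ?Evw ?Euw ?Ev; lia.
have d2 : s ^+ (2 * (m S).+1) %| mu (S :\ w) * mu (S :\ u :\ v).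
  by rewrite dvdp_mu_mul Ew Euv; lia.
rewrite -(dvdp_subr _ d1) -(dvdp_subl _ d2).
by apply: dN; apply: dvdp_sub; rewrite dvdp_mu_mul ?Eu ?Ev ?Ew ?Euv ?Euw ?Evw; lia.
Qed.

End Multiplicity.

(** * Additivity of nice sets and the greedy choice of partners *)

Section NiceSets.
Variables (R : rcfType) (T : finType) (e : rel T) (theta : R).
Hypotheses (e_sym : symmetric e) (e_irr : irreflexive e).
Implicit Types (S X Y : {set T}) (u v w z : T).
Local Notation m S := (mult e theta S).

Lemma nice_del1 S X x : nice e theta S X -> x \in X -> m (S :\ x) = (m S).+1.
Proof.
case=> sXS [X1 nX] xX.
have /card_gt0P[v] : 0 < #|X :\ x| by move: X1; rewrite (cardsD1 x) xX.
rewrite !inE => /andP[vx vX]; have := nX x v xX vX; rewrite eq_sym vx => /(_ isT).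
have := mult_del_le theta e_sym e_irr S x.
by have := mult_del_le theta e_sym e_irr (S :\ x) v; lia.
Qed.

(** Delete one vertex x of [X'] and induct: [mult_del3] carries the pairwise hypothesis over to
    [S :\ x] and [X :\ x]. *)
Lemma pairwise_additive S X : X \subset S ->
  {in X, forall x, m (S :\ x) = (m S).+1} ->
  {in X &, forall x x', x != x' -> m (S :\ x :\ x') = (m S).+2} ->
  forall X', X' \subset X -> m (S :\: X') = m S + #|X'|.
Proof.
move=> sXS X1 X2 X'; have [n] := ubnP #|X'|.
elim: n S X X' sXS X1 X2 => // n IH S X X' sXS X1 X2 cX' sX'.
have [->|[x xX']] := set_0Vmem X'; first by rewrite setD0 cards0 addn0.
have xX := subsetP sX' x xX'.
have cE : #|X'| = #|X' :\ x|.+1 by rewrite (cardsD1 x) xX'.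
have -> : S :\: X' = (S :\ x) :\: (X' :\ x) by rewrite setDDl setD1K.
rewrite (IH (S :\ x) (X :\ x)) ?X1 ?cE ?addSnnS //; last 1 first.
- exact: setSD.
- exact: setSD.
- by move=> v /setD1P[vx vX]; rewrite X2 ?X1 // eq_sym.
- move=> v w /setD1P[vx vX] /setD1P[wx wX] vw.
  have inS z : z \in X -> z \in S by move/(subsetP sXS).
  by apply: mult_del3; rewrite ?X1 ?X2 ?inE ?vx ?wx ?inS //= eq_sym ?vw ?vx ?wx.
- by rewrite -ltnS -cE.
Qed.

(** Unlike niceness, this makes sense for sets of size 0 and 1, so the greedy induction can run down
    to the empty set. *)
Definition additive S X := X \subset S /\
  forall X', X' \subset X -> m (S :\: X') = m S + #|X'|.

Lemma nice_additive S X : nice e theta S X -> additive S X.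
Proof.
move=> nX; have [sXS [_ X2]] := nX; split=> //; apply: pairwise_additive => //.
  by move=> x; apply: nice_del1.
by move=> x x' xX x'X xx'; rewrite X2 // addn2.
Qed.

(** An essential neighbour y of x lies outside [X], since deleting two vertices of [X] raises the
    multiplicity by 2. Deleting y costs at most the 1 gained from x, so [X :\ x] stays additive. *)
Lemma additive_del_edge S X x : additive S X -> x \in X ->
  exists y, [/\ y \in S :\: X, e x y, m (S :\ x :\ y) = m S &
    additive (S :\ x :\ y) (X :\ x)].
Proof.
case=> sXS aX xX; have xS := subsetP sXS x xX.
have m1 : m (S :\ x) = (m S).+1 by rewrite aX ?sub1set // cards1 addn1.
have [y [ySx xy my]] := exists_essential_neighbour e_sym e_irr xS m1.
have [yx yS] := setD1P ySx.
have yX : y \notin X.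
  apply/negP => yX; have := aX [set x; y].
  by rewrite -setDDl my subUset !sub1set xX yX cards2 eq_sym yx => /(_ isT); lia.
exists y; split=> //; first by rewrite !inE yX.
split=> [|X' sX'].
  by rewrite subsetD1 setSD //= !inE (negPf yX) andbF.
rewrite my; apply/eqP; rewrite eqn_leq; apply/andP; split.
  by rewrite -my; apply: mult_setD_le.
have -> : S :\ x :\ y :\: X' = (S :\: (x |: X')) :\ y.
  by rewrite !setDDl; congr (_ :\: _); rewrite setUA setUAC.
have [xX' sX'X] : x \notin X' /\ X' \subset X.
  by move: sX'; rewrite subsetD1 => /andP[].
have := mult_le_del theta e_sym e_irr (S :\: (x |: X')) y.
by rewrite aX ?subUset ?sub1set ?xX // cardsU1 xX'; lia.
Qed.

Lemma additive_matching S X : additive S X ->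
  exists y : T -> T, [/\ {in X &, injective y},
    {in X, forall x, y x \in S :\: X}, {in X, forall x, e x (y x)} &
    m (S :\: (X :|: y @: X)) = m S].
Proof.
have [n] := ubnP #|X|; elim: n S X => // n IH S X cX aX.
have [->|[x xX]] := set_0Vmem X.
  exists id; rewrite imset0 setU0 setD0; split=> // z; by rewrite inE.
have [y0 [y0S xy0 m0 aX']] := additive_del_edge aX xX.
have [|y [yI yS ye ym]] := IH _ _ _ aX'; first by move: cX; rewrite (cardsD1 x) xX.
have [sXS _] := aX.
have yN z : z \in X -> z != x -> [/\ y z != y0, y z != x, y z \in S & y z \notin X].
  move=> zX zx; have := yS z; rewrite !inE zx zX => /(_ isT).
  by case: (eqVneq (y z) x) => [->|yx] /=; rewrite ?xX ?andbF //= => /and3P[-> -> ->].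
pose y' z := if z == x then y0 else y z.
have y'x : y' x = y0 by rewrite /y' eqxx.
have y'N z : z != x -> y' z = y z by rewrite /y' => /negPf->.
exists y'; split.
- move=> z z' zX z'X; rewrite /y'.
  case: (eqVneq z x) => [->|zx]; case: (eqVneq z' x) => [->|z'x] //.
  + by have [/eqP N _ _ _] := yN z' z'X z'x => E; case: N.
  + by have [/eqP N _ _ _] := yN z zX zx => E; case: N.
  + by apply: yI; rewrite !inE ?zx ?z'x.
- move=> z zX; have [->|zx] := eqVneq z x; first by rewrite y'x.
  by have [_ _ yzS yzX] := yN z zX zx; rewrite y'N // inE yzX.
- move=> z zX; have [->|zx] := eqVneq z x; first by rewrite y'x.
  by rewrite y'N // ye // !inE zx.
- rewrite -m0 -ym; congr (m _).
  rewrite !setDDl; congr (_ :\: _).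
  have E : y' @: X = y0 |: y @: (X :\ x).
    rewrite -{1}(setD1K xX) imsetU1 y'x; congr (_ |: _).
    by apply: eq_in_imset => z /setD1P[zx _]; rewrite y'N.
  by rewrite E -{1}(setD1K xX) -!setUA; congr (_ |: _); rewrite setUCA.
Qed.

(** * Submatchings and independence for a fixed choice of partners *)

Section Matching.
Variables (S X : {set T}) (y : T -> T).
Hypotheses (aX : additive S X) (yI : {in X &, injective y})
  (yS : {in X, forall x, y x \in S :\: X}) (ye : {in X, forall x, e x (y x)})
  (ym : m (S :\: (X :|: y @: X)) = m S).

Let card_y X' : X' \subset X -> #|y @: X'| = #|X'|.
Proof.
move=> sX'; apply: card_in_imset => u v uX vX; apply: yI; exact: subsetP sX' _ _.
Qed.

(** Downward induction from [X' = X], which is [ym]; each restored edge is handled by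
    [special_positive]. *)
Lemma mult_del_submatching X' : X' \subset X ->
  m (S :\: (X' :|: y @: X')) = m S.
Proof.
have [n] := ubnP #|X :\: X'|; elim: n X' => // n IH X' cX' sX'.
have [E|[x]] := set_0Vmem (X :\: X').
  have -> // : X' = X by apply/eqP; rewrite eqEsubset sX' -setD_eq0 E eqxx.
move=> /setDP[xX xX'].
have [sXS aXX] := aX.
have [] := setDP (yS xX) => yxS yxX.
have ynx : y x != x by apply: contraNneq yxX => ->.
have sxX' : x |: X' \subset X by rewrite subUset sub1set xX.
set F := S :\: (X' :|: y @: X').
have EF : F :\ x :\ y x = S :\: ((x |: X') :|: y @: (x |: X')).
  rewrite imsetU1 !setDDl; congr (_ :\: _).
  by apply/setP => z; rewrite !inE; do !case: (_ == _); rewrite ?orbT ?orbF.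
have mF : m (F :\ x :\ y x) = m S.
  rewrite EF IH //; move: cX'; rewrite (cardsD1 x) !inE xX xX' /=.
  by rewrite setDDl setUC add1n ltnS.
rewrite -mF; apply: special_positive (ye xX) _ => //.
- rewrite !inE (subsetP sXS) // (negPf xX') /= andbT.
  apply/imsetP => -[z zX' E]; have := yS (subsetP sX' z zX').
  by rewrite -E inE xX.
- rewrite !inE ynx yxS andbT /= negb_or; apply/andP; split.
    by apply: contraNN yxX => /(subsetP sX').
  apply/imsetP => -[z zX' /(yI xX (subsetP sX' z zX')) E].
  by rewrite E zX' in xX'.
(* The lower bound: deleting x and [X'] gains |X'| + 1, and the partners of [X'] take back at most
   |X'|. *)
rewrite mF; apply/eqP; rewrite eqn_leq; apply/andP; split.
  by rewrite -mF; apply: mult_le_del.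
have -> : F :\ x = S :\: (x |: X') :\: y @: X'.
  by rewrite !setDDl; congr (_ :\: _); rewrite setUC setUA.
have := mult_le_setD theta e_sym e_irr (S :\: (x |: X')) (y @: X').
by rewrite aXX // cardsU1 xX' card_y //; lia.
Qed.

Lemma submatching_nice X' : X' \subset X -> 1 < #|X :\: X'| ->
  nice e theta (S :\: (X' :|: y @: X')) (X :\: X').
Proof.
move=> sX' c1; have [sXS aXX] := aX; split; last split=> //.
  apply/subsetP => x /setDP[xX xX']; rewrite !inE (negPf xX') (subsetP sXS) // andbT.
  apply/imsetP => -[z zX' E]; have := yS (subsetP sX' z zX').
  by rewrite -E inE xX.
move=> u v /setDP[uX uX'] /setDP[vX vX'] uv; rewrite mult_del_submatching //.
set F := S :\: (X' :|: _); have mF : m F = m S by apply: mult_del_submatching.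
apply/eqP; rewrite eqn_leq; apply/andP; split.
  have := mult_del_le theta e_sym e_irr (F :\ u) v.
  have := mult_del_le theta e_sym e_irr F u.
  by rewrite mF; lia.
have -> : F :\ u :\ v = S :\: (u |: (v |: X')) :\: y @: X'.
  rewrite !setDDl; congr (_ :\: _).
  by apply/setP => z; rewrite !inE; do !case: (_ == _); rewrite ?orbT ?orbF.
have := mult_le_setD theta e_sym e_irr (S :\: (u |: (v |: X'))) (y @: X').
rewrite aXX ?subUset ?sub1set ?uX ?vX // !cardsU1 !inE (negPf uv) uX' vX' card_y //.
by lia.
Qed.

(** Deleting all |X| partners from G-X lowers the multiplicity by |X| in total and by at most 1
    each, so every deletion lowers it by exactly 1. *)
Lemma mult_del_partners Y : Y \subset y @: X ->
  m (S :\: X :\: Y) + #|Y| = m S + #|X|.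
Proof.
move=> sY; have [sXS aXX] := aX.
have := mult_le_setD theta e_sym e_irr (S :\: X) Y; rewrite aXX //.
have := mult_le_setD theta e_sym e_irr (S :\: X :\: Y) ((y @: X) :\: Y).
have EY : Y :|: (y @: X :\: Y) = y @: X by rewrite -{1}(setIidPr sY) setID.
rewrite [_ :\: Y :\: _]setDDl EY (setDDl S X (y @: X)) ym.
have := cardsID Y (y @: X); rewrite (setIidPr sY) card_y //; lia.
Qed.

Lemma partners_independent x x' : x \in X -> x' \in X -> ~~ e (y x) (y x').
Proof.
move=> xX x'X; have [->|xx'] := eqVneq x x'; first by rewrite e_irr.
have yxx' : y x != y x' by apply: contraNneq xx' => /yI->.
have c2 : #|X| = #|X :\ x :\ x'|.+2.
  by rewrite (cardsD1 x) xX (cardsD1 x' (X :\ x)) !inE eq_sym xx' x'X.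
have sy z : z \in X -> [set y z] \subset y @: X by move=> zX; rewrite sub1set imset_f.
have m0 := mult_del_partners (sub0set (y @: X)).
have m1 := mult_del_partners (sy x xX).
have m1' := mult_del_partners (sy x' x'X).
have : [set y x; y x'] \subset y @: X by rewrite subUset !sy.
move/mult_del_partners; rewrite -setDDl => m2.
rewrite setD0 cards0 addn0 c2 in m0.
rewrite !cards1 c2 in m1 m1'; rewrite cards2 yxx' c2 in m2.
(* Here l = k + |X| - 2, with k the multiplicity in [S]. *)
apply: (@essential_pair_nonadjacent _ _ _ theta e_sym e_irr (S :\: X) _ _
  (m S + #|X :\ x :\ x'|)) => //; [exact: yS | | lia..].
by rewrite in_setD1 eq_sym yxx' yS.
Qed.

End Matching.
End NiceSets.

(* The vertex y_i matched to x_i is given by the function y (relevant on X). *)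
Theorem theorem6p4 (R : rcfType) (T : finType) (e : rel T)
    (Hg : simple_graph e) (theta : R) (X : {set T})
    (Hm : 2 <= #|X|) (Hnice : nice e theta [set: T] X) :
  exists y : T -> T,
    [/\ (* Y = y @: X is disjoint from X and |Y| = m *)
        {in X &, injective y},
        (forall x, x \in X -> y x \notin X),
        (* (i) each x_i y_i is an edge, so M is a matching of size m *)
        (forall x, x \in X -> e x (y x)),
        (* (ii) for every M' ⊆ M, i.e. M' = {x y x | x in X'} with X' ⊆ X *)
        (forall X' : {set T}, X' \subset X ->
           mult e theta (~: (X' :|: y @: X')) = mult e theta [set: T] /\
           (1 < #|X :\: X'| ->
              nice e theta (~: (X' :|: y @: X')) (X :\: X')))
      & (* (iii) Y is independent *)
        (forall x x', x \in X -> x' \in X -> ~~ e (y x) (y x'))].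
Proof.
case: Hg => e_sym e_irr.
have aX := nice_additive e_sym e_irr Hnice.
have [y [yI yS ye ym]] := additive_matching e_sym e_irr aX.
exists y; split=> // [x /yS|X' sX'|].
- by rewrite inE => /andP[].
- rewrite -setTD; split; first exact: (mult_del_submatching e_sym e_irr aX).
  exact: (submatching_nice e_sym e_irr aX).
- exact: (partners_independent e_sym e_irr aX).
Qed.
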